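(* Let $N=M=1$ and $\sigma>0$. For every GKP-stabilizer code $(\bm S_{\rm enc},\bm M,\bm f)$ with $\bm S_{\rm enc}\in{\rm Sp}(4,\mathbb R)$ whose ancilla lattice is canonical (i.e. $\bm M^\top\bm\Omega_1\bm M=2\pi\bm\Omega_1$), there exist a gain $G\ge1$, a matrix $\bm\Lambda\in{\rm Sp}(2,\mathbb R)$ and a measurable estimator $\bm f'$ such that the TMS code with encoding $\bm S_G$, ancilla lattice generator $\sqrt{2\pi}\,\bm\Lambda\bm\Omega_1$ (the square lattice transformed by $\bm\Lambda$) and estimator $\bm f'$ has the same geometric-mean error. Hence the optimal such code, in terms of geometric-mean error, is a TMS code with a single-mode lattice obtained from the square lattice by a symplectic transformation.
   Context: $\bm\Omega_1=\begin{pmatrix}0&1\\-1&0\end{pmatrix}$, $\bm\Omega=\bm\Omega_1\oplus\bm\Omega_1$ on two modes; ${\rm Sp}(2n,\mathbb R)=\{\bm S:\bm S\bm\Omega\bm S^\top=\bm\Omega\}$. $\bm S_G=\begin{pmatrix}\sqrt G\bm I_2&\sqrt{G-1}\bm Z\\ \sqrt{G-1}\bm Z&\sqrt G\bm I_2\end{pmatrix}$, $\bm Z={\rm diag}(1,-1)$. $R_{\sqrt{2\pi}}$ reduces each coordinate modulo $\sqrt{2\pi}$ into $[-\sqrt{\pi/2},\sqrt{\pi/2})$. Code model: mode 1 is data, mode 2 ancilla; a code $(\bm S_{\rm enc},\bm M,\bm f)$ has $\bm S_{\rm enc}\in{\rm Sp}(4,\mathbb R)$, invertible lattice generator $\bm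 M\in\mathbb R^{2\times2}$, measurable $\bm f:\mathbb R^2\to\mathbb R^2$; with $\bm\xi\sim\mathcal N(0,\sigma^2\bm I_4)$, $\bm x=\bm S_{\rm enc}^{-1}\bm\xi=(\bm x_d,\bm x_a)$, syndrome $\bm s=R_{\sqrt{2\pi}}(\bm M^\top\bm\Omega_1\bm x_a)$, residual $\bm\varepsilon=\bm x_d-\bm f(\bm s)$, $\bm V_{\rm out}=\mathbb E[\bm\varepsilon\bm\varepsilon^\top]$, geometric-mean error $\bar\sigma^2_{\rm GM}=(\det\bm V_{\rm out})^{1/2}$. *)

(* Defs.v *)
From HB Require Import structures.
From mathcomp Require Import all_boot all_order all_algebra.
From mathcomp Require Import all_classical all_reals all_analysis.
Set Implicit Arguments. Unset Strict Implicit. Unset Printing Implicit Defensive.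
Import Order.TTheory GRing.Theory Num.Theory.
Local Open Scope classical_set_scope.
Local Open Scope ring_scope.

Section GKP.
Variable R : realType.

Definition Omega1 : 'M[R]_2 :=
  \matrix_(i < 2, j < 2)
    (if (i == 0 :> nat) && (j == 1 :> nat) then 1
     else if (i == 1 :> nat) && (j == 0 :> nat) then -1 else 0).

Definition Omega : 'M[R]_(2 + 2) := block_mx Omega1 0 0 Omega1.

Definition symplectic n (Om : 'M[R]_n) (S : 'M[R]_n) : Prop :=
  S *m Om *m S^T = Om.

Definition Zmx : 'M[R]_2 :=
  \matrix_(i < 2, j < 2) (if i == j then (if i == 0 :> nat then 1 else -1) else 0).

Definition S_TMS (G : R) : 'M[R]_(2 + 2) :=
  block_mx (Num.sqrt G)%:M (Num.sqrt (G - 1) *: Zmx)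
           (Num.sqrt (G - 1) *: Zmx) (Num.sqrt G)%:M.

(* reduction of a real number modulo a into [-a/2, a/2) *)
Definition redmod (a t : R) : R := t - a * (Num.floor ((t + a / 2) / a))%:~R.

Definition sqrt2pi : R := Num.sqrt (2 * pi).

Definition Rred (v : 'cV[R]_2) : 'cV[R]_2 := \col_i redmod sqrt2pi (v i 0).

Definition vec4 (a b c d : R) : 'cV[R]_(2 + 2) :=
  \col_(i < 2 + 2) nth 0 [:: a; b; c; d] i.

Definition cv2 (p : R * R) : 'cV[R]_2 := \col_(i < 2) (if i == 0 :> nat then p.1 else p.2).
Definition pr2 (v : 'cV[R]_2) : R * R := (v 0 0, v 1 0).

Definition residual (S : 'M[R]_(2 + 2)) (M : 'M[R]_2) (f : R * R -> R * R)
    (a b c d : R) : 'cV[R]_2 :=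
  let x := invmx S *m vec4 a b c d in
  let xd := usubmx x in
  let xa := dsubmx x in
  let s := Rred (M^T *m Omega1 *m xa) in
  xd - cv2 (f (pr2 s)).

(* expectation over xi ~ N(0, sigma^2 I_4) as an iterated Lebesgue integral
   against the product Gaussian density (normal_pdf 0 sigma has standard
   deviation sigma) *)
Definition gaussE (sigma : R) (g : R -> R -> R -> R -> \bar R) : \bar R :=
  (\int[lebesgue_measure]_a \int[lebesgue_measure]_b
   \int[lebesgue_measure]_c \int[lebesgue_measure]_d
     ((normal_pdf 0 sigma a * normal_pdf 0 sigma b *
       normal_pdf 0 sigma c * normal_pdf 0 sigma d)%:E * g a b c d))%E.

(* the residual has finite second moments, so V_out is well defined *)
Definition finite_second_moments (sigma : R) S M f : Prop :=
  forall i : 'I_2,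
    (gaussE sigma (fun a b c d => ((residual S M f a b c d i 0) ^+ 2)%:E) < +oo)%E.

Definition Vout (sigma : R) S M f : 'M[R]_2 :=
  \matrix_(i < 2, j < 2)
    fine (gaussE sigma (fun a b c d =>
      (residual S M f a b c d i 0 * residual S M f a b c d j 0)%:E)).

Definition gm_error (sigma : R) S M f : R := Num.sqrt (\det (Vout sigma S M f)).

End GKP.

(* Main.v *)
Require Import Defs.
From HB Require Import structures.
From mathcomp Require Import all_boot all_order all_algebra.
From mathcomp Require Import all_classical all_reals all_analysis.
From mathcomp Require Import perm measurable_realfun ring lra.
Import Order.TTheory GRing.Theory Num.Theory.
Local Open Scope classical_set_scope.
Local Open Scope ring_scope.

Set Implicit Arguments. Unset Strict Implicit. Unset Printing Implicit Defensive.

(** The residual depends on [Senc] only through the law of [x = Senc^-1 xi], a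
    centred Gaussian with covariance [sigma^2 Senc^-1 Senc^-T].  Bringing the two
    diagonal blocks of this symplectic Gram matrix to scalar form with matrices
    [A], [B] of determinant 1 turns it into [(A + B) S_G^-2 (A + B)^T] (direct
    sums), so that [O = Senc (A + B) S_G^-1] is orthogonal.  Hence
    [x(O xi) = (A + B) S_G^-1 xi]: the map [B] is absorbed in the lattice
    ([M' = B^-1 M], so [Lambda] is fixed by [M' = sqrt(2 pi) Lambda Omega_1]), and
    [A] in the estimator ([f' = A^-1 f]).  The new residual at [xi] is [A^-1] times
    the old one at [O xi]; rotation invariance of the Gaussian then gives
    [V' = A^-1 V A^-T], with the same determinant.

    Rotation invariance: by LUP decomposition an invertible linear map of [R^4]
    multiplies Lebesgue integrals by a constant, and for an orthogonal map
    integrating the Gaussian density shows that this constant is 1. *)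

(** * Affine substitution and iterated integrals *)

Section lebesgue_affine.
Context {R : realType}.
Local Notation mu := (@lebesgue_measure R).
Local Open Scope ereal_scope.

Lemma ge0_integral_oppr (g : R -> \bar R) : measurable_fun setT g ->
  (forall x, 0 <= g x) -> \int[mu]_x g (- x)%R = \int[mu]_x g x.
Proof.
move=> mg g0; rewrite -[LHS]/(\int[mu]_(x in (-%R : _ -> measurableTypeR R) @^-1` [set: R])
  (g \o (-%R : _ -> measurableTypeR R)) x).
rewrite -ge0_integral_pushforward//=.
by apply: eq_measure_integral => //= A mA _; exact: lebesgue_measureN.
Qed.

Lemma measurable_affine (t k : R) :
  measurable_fun setT (fun x : measurableTypeR R => (t + k * x)%R : measurableTypeR R).
Proof. by apply: measurable_funD => //; exact: measurable_funM. Qed.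

(** Uniqueness of Lebesgue measure: [k] times the pushforward by the affine map gives every
    half-open interval its length. *)
Lemma lebesgue_measure_affine (t k : R) (A : set R) : (0 < k)%R ->
  measurable A -> mu A = k%:E * mu ((fun x : R => t + k * x)%R @^-1` A).
Proof.
move=> kp mA.
pose m := measure_function_pushforward__canonical__measure_function_Measure
  mu (measurable_affine t k).
apply: (@lebesgue_measure_unique R (mscale (NngNum (ltW kp)) m)) => //= _ [[a b]] _ <-.
rewrite /mscale /= /pushforward.
rewrite (_ : _ @^-1` _ = `]((a - t) / k)%R, ((b - t) / k)%R]%classic); last first.
  apply/seteqP; split => x /=; rewrite !in_itv/= ltr_pdivrMr// ler_pdivlMr//;
    by rewrite ltrBlDl lerBrDl [(x * k)%R]mulrC.
rewrite !lebesgue_measure_itv/= !lte_fin ltr_pM2r ?invr_gt0// ltrD2r.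
case: ifP => _; rewrite ?mule0// -!EFinD -EFinM; congr (_%:E).
by field; rewrite gt_eqF.
Qed.

Lemma ge0_integral_affine (t k : R) (g : R -> \bar R) : k != 0%R ->
  measurable_fun setT g -> (forall x, 0 <= g x) ->
  \int[mu]_x g (t + k * x)%R = `|k|^-1%:E * \int[mu]_x g x.
Proof.
move=> k0 mg g0.
(* A negative slope is handled by composing the case of [- k] with the reflection [x] to [- x]. *)
wlog kp : k k0 / (0 < k)%R.
  move=> H; have [kp|kn] := ltP 0%R k; first exact: H.
  have kn' : (0 < - k)%R by rewrite oppr_gt0 lt_neqAle k0.
  rewrite -normrN -(H (- k)%R) ?oppr_eq0//.
  rewrite -(@ge0_integral_oppr (fun x => g (t + - k * x)%R))//.
    by apply: eq_integral => x _; rewrite mulrNN.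
  exact: measurableT_comp mg (measurable_affine t (- k)).
rewrite gtr0_norm//.
rewrite -[LHS]/(\int[mu]_(x in (fun x : R => t + k * x)%R @^-1` [set: R])
  (g \o (fun x : R => t + k * x)%R) x).
rewrite -(ge0_integral_pushforward (measurable_affine t k))//.
pose nu := measure_function_pushforward__canonical__measure_function_Measure
  mu (measurable_affine t k).
have -> : \int[mu]_x g x = k%:E * \int[nu]_x g x.
  rewrite -[k]/(NngNum (ltW kp))%:num -ge0_integral_mscale//.
  by apply: eq_measure_integral => //= A mA _; rewrite (lebesgue_measure_affine t kp).
by rewrite muleA -EFinM mulVf// mul1e.
Qed.

End lebesgue_affine.

Section product_sigma_finite.
Local Open Scope ereal_scope.
Context d1 d2 (T1 : measurableType d1) (T2 : measurableType d2) (R : realType).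
Variables (m1 : {sigma_finite_measure set T1 -> \bar R})
  (m2 : {sigma_finite_measure set T2 -> \bar R}).

(* The library only attaches a canonical sigma-finite structure to [m1 \x m2]
   when both factors are subprobabilities, which does not cover Lebesgue measure. *)
Definition prod_sfm : set (T1 * T2)%type -> \bar R := m1 \x m2.

HB.instance Definition _ := Measure.copy prod_sfm (m1 \x m2).

Lemma prod_sfm_sigma_finite : sigma_finite setT prod_sfm.
Proof.
have /sigma_finiteP[F [FT ndF Ffin]] := sigma_finiteT m1.
have /sigma_finiteP[G [GT ndG Gfin]] := sigma_finiteT m2.
(* Both exhausting sequences are increasing, so a point covered at stages [i] and [j] lies in the
   rectangle of index [maxn i j]. *)
exists (fun n => F n `*` G n).
  apply/seteqP; split=> // -[x y] _.
  have [i _ Fx] : (\bigcup_i F i) x by rewrite -FT.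
  have [j _ Gy] : (\bigcup_i G i) y by rewrite -GT.
  exists (maxn i j) => //; split=> /=.
    by have /subsetPset := ndF _ _ (leq_maxl i j); exact.
  by have /subsetPset := ndG _ _ (leq_maxr i j); exact.
move=> n; have [mF Fy] := Ffin n; have [mG Gy] := Gfin n.
split; first exact: measurableX.
by rewrite /prod_sfm product_measure1E// lte_mul_pinfty// ge0_fin_numE.
Qed.

HB.instance Definition _ :=
  Measure_isSigmaFinite.Build _ _ _ prod_sfm prod_sfm_sigma_finite.

Lemma ge0_integral_prod_sfm (g : T1 * T2 -> \bar R) : measurable_fun setT g ->
  (forall x, 0 <= g x) -> \int[prod_sfm]_p g p = \int[m1]_x \int[m2]_y g (x, y).
Proof. exact: fubini_tonelli1. Qed.

Lemma ge0_integral_prod_sfmC (g : T1 * T2 -> \bar R) : measurable_fun setT g ->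
  (forall x, 0 <= g x) -> \int[prod_sfm]_p g p = \int[m2]_y \int[m1]_x g (x, y).
Proof. exact: fubini_tonelli2. Qed.

Lemma measurable_section_integral (g : T1 * T2 -> \bar R) :
  measurable_fun setT g -> (forall x, 0 <= g x) ->
  measurable_fun setT (fun x => \int[m2]_y g (x, y)).
Proof. exact: measurable_fun_fubini_tonelli_F. Qed.

Lemma integral_prod_sfm (g : T1 * T2 -> \bar R) :
  prod_sfm.-integrable setT g ->
  \int[prod_sfm]_p g p = \int[m1]_x \int[m2]_y g (x, y).
Proof. by move=> ig; apply/esym; exact: integral12_prod_meas1. Qed.

Lemma integrable_section_integral (g : T1 * T2 -> \bar R) :
  prod_sfm.-integrable setT g ->
  m1.-integrable setT (fun x => \int[m2]_y g (x, y)).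
Proof. exact: integrable_fubini_F. Qed.

End product_sigma_finite.

Section iterated_integrals.
Local Open Scope ereal_scope.
Context d1 d2 d3 d4 (T1 : measurableType d1) (T2 : measurableType d2)
  (T3 : measurableType d3) (T4 : measurableType d4) (R : realType).
Variables (m1 : {sigma_finite_measure set T1 -> \bar R})
  (m2 : {sigma_finite_measure set T2 -> \bar R})
  (m3 : {sigma_finite_measure set T3 -> \bar R})
  (m4 : {sigma_finite_measure set T4 -> \bar R}).

Lemma ge0_integral_prod3 (g : T1 * T2 * T3 -> \bar R) :
  measurable_fun setT g -> (forall x, 0 <= g x) ->
  \int[prod_sfm (prod_sfm m1 m2) m3]_p g p =
  \int[m1]_x \int[m2]_y \int[m3]_z g (x, y, z).
Proof.
move=> mg g0; rewrite ge0_integral_prod_sfm//.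
apply: (@ge0_integral_prod_sfm _ _ _ _ _ _ _ (fun q => \int[m3]_z g (q, z))).
  exact: measurable_section_integral.
by move=> x; apply: integral_ge0.
Qed.

Lemma ge0_integral_prod4 (g : T1 * T2 * T3 * T4 -> \bar R) :
  measurable_fun setT g -> (forall x, 0 <= g x) ->
  \int[prod_sfm (prod_sfm (prod_sfm m1 m2) m3) m4]_p g p =
  \int[m1]_x \int[m2]_y \int[m3]_z \int[m4]_w g (x, y, z, w).
Proof.
move=> mg g0; rewrite ge0_integral_prod_sfm//.
apply: (@ge0_integral_prod3 (fun q => \int[m4]_w g (q, w))).
  exact: measurable_section_integral.
by move=> x; apply: integral_ge0.
Qed.

Lemma integral_prod4 (g : T1 * T2 * T3 * T4 -> \bar R) :
  (prod_sfm (prod_sfm (prod_sfm m1 m2) m3) m4).-integrable setT g ->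
  \int[prod_sfm (prod_sfm (prod_sfm m1 m2) m3) m4]_p g p =
  \int[m1]_x \int[m2]_y \int[m3]_z \int[m4]_w g (x, y, z, w).
Proof.
move=> ig; have i3 := integrable_section_integral ig.
have i2 := integrable_section_integral i3.
by rewrite (integral_prod_sfm ig) (integral_prod_sfm i3) (integral_prod_sfm i2).
Qed.

End iterated_integrals.

(** A change of variables with unspecified Jacobian: for an invertible linear map, [c] is the
    inverse of the absolute value of its determinant. Keeping [c] abstract avoids tracking
    determinants through compositions. *)
Definition integral_scales (R : realType) d (X : measurableType d)
  (nu : set X -> \bar R) (c : R) (phi : X -> X) := measurable_fun setT phi /\
  forall g : X -> \bar R, measurable_fun setT g -> (forall x, 0 <= g x)%E ->
    (\int[nu]_x g (phi x) = c%:E * \int[nu]_x g x)%E.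

Section integral_scales_theory.
Local Open Scope ereal_scope.
Context d1 d2 (T1 : measurableType d1) (T2 : measurableType d2) (R : realType).
Variables (m1 : {sigma_finite_measure set T1 -> \bar R})
  (m2 : {sigma_finite_measure set T2 -> \bar R}).

Lemma integral_scales_comp (c1 c2 : R) (phi psi : T1 -> T1) :
  integral_scales m1 c1 phi -> integral_scales m1 c2 psi ->
  integral_scales m1 (c2 * c1) (phi \o psi).
Proof.
move=> [mphi phiP] [mpsi psiP]; split; first exact: measurableT_comp.
move=> g mg g0.
rewrite (psiP (g \o phi) (measurableT_comp mg mphi) (fun x => g0 _)).
by rewrite (phiP g mg g0) muleA EFinM.
Qed.

(** By Tonelli, the inner integral is rescaled at a fixed first coordinate and the outer one
    afterwards. The factor [k] must be the same on all fibers. *)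
Lemma integral_scales_fibered (c k : R) (phi : T1 -> T1) (psi : T1 * T2 -> T2) :
  (0 <= k)%R -> measurable_fun setT psi ->
  (forall x, integral_scales m2 k (fun y => psi (x, y))) ->
  integral_scales m1 c phi ->
  integral_scales (prod_sfm m1 m2) (k * c) (fun p => (phi p.1, psi p)).
Proof.
move=> k0 mpsi psiP [mphi phiP].
have mpair : measurable_fun setT (fun p : T1 * T2 => (phi p.1, psi p)).
  by apply: measurable_fun_pair => //; exact: measurableT_comp.
split=> [//|g mg g0].
rewrite ge0_integral_prod_sfm//=; last exact: measurableT_comp mg mpair.
rewrite (ge0_integral_prod_sfm _ _ mg g0).
have mG := measurable_section_integral m2 mg g0.
transitivity (\int[m1]_x (k%:E * \int[m2]_y g (phi x, y))).
  apply: eq_integral => x _; apply: (psiP x).2 => //.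
  exact: measurableT_comp mg (measurable_pair1 _).
rewrite ge0_integralZl//=.
- by rewrite (phiP _ mG) ?EFinM ?muleA// => x; exact: integral_ge0.
- exact: measurableT_comp mG mphi.
- by move=> x _; exact: integral_ge0.
Qed.

Lemma integral_scales_swap2 :
  integral_scales (prod_sfm m2 m2) 1 (fun p => (p.2, p.1)).
Proof.
have mswap : measurable_fun setT (fun p : T2 * T2 => (p.2, p.1)).
  exact: measurable_fun_pair.
split=> [//|g mg g0]; rewrite mul1e (ge0_integral_prod_sfm _ _ mg g0).
rewrite (@ge0_integral_prod_sfmC _ _ _ _ _ _ _ (fun p => g (p.2, p.1)))//.
exact: measurableT_comp mg mswap.
Qed.

(** Tonelli is applied to the last two coordinates, with the first one frozen. *)
Lemma integral_scales_swap3 :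
  integral_scales (prod_sfm (prod_sfm m1 m2) m2) 1 (fun p => (p.1.1, p.2, p.1.2)).
Proof.
have mswap : measurable_fun setT (fun p : T1 * T2 * T2 => (p.1.1, p.2, p.1.2)).
  apply: measurable_fun_pair => /=; last exact: measurableT_comp.
  by apply: measurable_fun_pair => //=; exact: measurableT_comp.
split=> [//|g mg g0]; rewrite mul1e.
rewrite (ge0_integral_prod3 _ _ _ mg g0).
rewrite (@ge0_integral_prod3 _ _ _ _ _ _ _ _ _ _ (fun p => g (p.1.1, p.2, p.1.2))); last 2 first.
- exact: measurableT_comp mg mswap.
- by move=> x; exact: g0.
apply: eq_integral => x _ /=.
apply: (fubini_tonelli (fun p => g (x, p.2, p.1))) => [|p]; last exact: g0.
apply: measurableT_comp => //.
by apply: measurable_fun_pair => //=; exact: measurable_fun_pair.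
Qed.

End integral_scales_theory.

(** * Linear substitution in dimension four *)

Lemma lup_decomposition (F : fieldType) n (A : 'M[F]_n.+1) :
  exists (s : {perm 'I_n.+1}) (L U : 'M[F]_n.+1),
  [/\ A = perm_mx s *m (L *m U),
      forall i j : 'I_n.+1, (i <= j)%N -> L i j = (i == j)%:R,
      forall i j : 'I_n.+1, (j < i)%N -> U i j = 0 & \det L = 1].
Proof.
have := cormen_lup_perm A; have := cormen_lup_correct A.
have := cormen_lup_detL A; have := @cormen_lup_lower _ _ A.
have := @cormen_lup_upper _ _ A.
case: (cormen_lup A) => -[P L] U /= HU HL detL E /is_perm_mxP[s Ps].
(* The algorithm yields [P * A = L * U]; moving [P] to the other side inverts the permutation. *)
exists s^-1%g, L, U; split => //.
by rewrite -[L *m U]E Ps -[_ * A]/(_ *m A) mulmxA -perm_mxM mulVg perm_mx1 mul1mx.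
Qed.

Section linear_substitution.
Context {R : realType}.
Local Notation mu := (@lebesgue_measure R).
(* [R] and [measurableTypeR R] carry the same sigma-algebra under different measure
   displays; [lebesgue_measure] is typed on the latter, so products are built on it. *)
Local Notation mR := (measurableTypeR R).
Local Notation R4 := (mR * mR * mR * mR)%type.

Local Notation lam4 := (prod_sfm (prod_sfm (prod_sfm mu mu) mu) mu).
Local Notation o0 := (@Ordinal 4 0 isT).
Local Notation o1 := (@Ordinal 4 1 isT).
Local Notation o2 := (@Ordinal 4 2 isT).
Local Notation o3 := (@Ordinal 4 3 isT).

(** Appends one coordinate, rescaled by [k] and translated by a function of the earlier ones: the
    step from which triangular maps are built. *)
Lemma integral_scales_shear d (T : measurableType d)
    (m : {sigma_finite_measure set T -> \bar R}) (c k : R) (phi : T -> T) (u : T -> mR) :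
  k != 0 -> measurable_fun setT u -> integral_scales m c phi ->
  integral_scales (prod_sfm m mu) (`|k|^-1 * c)
    (fun p : T * mR => (phi p.1, (u p.1 + k * p.2 : mR))).
Proof.
move=> k0 mu_ phiP.
apply: (@integral_scales_fibered _ _ _ mR _ m mu c `|k|^-1 phi
  (fun p => u p.1 + k * p.2)) => //.
- apply: measurable_funD; first exact: measurableT_comp.
  exact: measurable_funM.
- move=> x; split=> [|g mg g0]; first exact: (measurable_affine (u x) k).
  exact: (ge0_integral_affine (u x) k0 mg g0).
Qed.

Lemma ord4P (P : 'I_4 -> Prop) : P o0 -> P o1 -> P o2 -> P o3 -> forall i, P i.
Proof.
move=> P0 P1 P2 P3 [[|[|[|[|//]]]] Hi].
- by rewrite (_ : Ordinal Hi = o0)//; exact: val_inj.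
- by rewrite (_ : Ordinal Hi = o1)//; exact: val_inj.
- by rewrite (_ : Ordinal Hi = o2)//; exact: val_inj.
- by rewrite (_ : Ordinal Hi = o3)//; exact: val_inj.
Qed.

Lemma ord4_sym_ind (P : 'I_4 -> 'I_4 -> Prop) :
  (forall i j, P i j -> P j i) -> (forall i, P i i) ->
  P o0 o1 -> P o0 o2 -> P o0 o3 -> P o1 o2 -> P o1 o3 -> P o2 o3 ->
  forall i j, P i j.
Proof.
by move=> sym refl P01 P02 P03 P12 P13 P23; apply: ord4P; apply: ord4P;
  do [exact: refl | assumption | apply: sym; assumption].
Qed.

Lemma sum_ord4 (V : nmodType) (F : 'I_4 -> V) :
  \sum_i F i = F o0 + F o1 + F o2 + F o3.
Proof.
by rewrite !big_ord_recr big_ord0/= add0r; do !congr (_ + _); congr F; exact: val_inj.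
Qed.

Definition col4 (p : R4) : 'cV[R]_4 := vec4 p.1.1.1 p.1.1.2 p.1.2 p.2.
Definition uncol4 (v : 'cV[R]_4) : R4 := (v o0 0, v o1 0, v o2 0, v o3 0).

Lemma uncol4K : cancel uncol4 col4.
Proof. by move=> v; apply/colP; apply: ord4P; rewrite !mxE. Qed.

Definition linmap4 (A : 'M[R]_4) (p : R4) : R4 := uncol4 (A *m col4 p).

Lemma linmap4M A B : linmap4 (A *m B) = linmap4 A \o linmap4 B.
Proof. by apply/funext => p; rewrite /= /linmap4 uncol4K mulmxA. Qed.

Lemma mul_col4 (A : 'M[R]_4) p i : (A *m col4 p) i 0 =
  A i o0 * p.1.1.1 + A i o1 * p.1.1.2 + A i o2 * p.1.2 + A i o3 * p.2.
Proof. by rewrite mxE sum_ord4 !mxE. Qed.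

Lemma measurable_mul_col4 (A : 'M[R]_4) i :
  measurable_fun setT (fun p => (A *m col4 p) i 0).
Proof.
under eq_fun do rewrite mul_col4.
by repeat (apply: measurable_funD || apply: measurable_funM => //);
  repeat apply: measurableT_comp => //.
Qed.

(** The constant is existential, since only stability under products matters until the map is known
    to be orthogonal. *)
Definition scales4 (A : 'M[R]_4) :=
  exists2 c : R, 0 < c & integral_scales lam4 c (linmap4 A).

Lemma scales4M A B : scales4 A -> scales4 B -> scales4 (A *m B).
Proof.
move=> [c c0 Ac] [d d0 Bd]; exists (d * c); first exact: mulr_gt0.
rewrite linmap4M; exact: integral_scales_comp Ac Bd.
Qed.

(** Row [i] of a lower triangular map is [L i i] times coordinate [i] plus a linear form in the
    earlier coordinates, so the map is a tower of shears. *)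
Lemma scales4_lower (L : 'M[R]_4) :
  (forall i j : 'I_4, (i < j)%N -> L i j = 0) -> \det L != 0 -> scales4 L.
Proof.
move=> L0 detL.
have Lii i : L i i != 0.
  have trigL : is_trig_mx L by apply/is_trig_mxP => i' j /L0.
  move: detL; rewrite det_trig// => /prodf_neq0; exact.
have s1 : integral_scales mu `|L o0 o0|^-1 (fun x : mR => (0 + L o0 o0 * x : mR)).
  split=> [|g mg g0]; first exact: measurable_affine.
  exact: (ge0_integral_affine 0 (Lii o0) mg g0).
have m1 : measurable_fun setT (fun p : mR => (L o1 o0 * p : mR)).
  exact: measurable_funM.
have m2 : measurable_fun setT (fun p : mR * mR => (L o2 o0 * p.1 + L o2 o1 * p.2 : mR)).
  by apply: measurable_funD; apply: measurable_funM.
have m3 : measurable_fun setT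
    (fun p : mR * mR * mR => (L o3 o0 * p.1.1 + L o3 o1 * p.1.2 + L o3 o2 * p.2 : mR)).
  by do 2?apply: measurable_funD; apply: measurable_funM => //; exact: measurableT_comp.
have s2 := integral_scales_shear (Lii o1) m1 s1.
have s3 := integral_scales_shear (Lii o2) m2 s2.
have s4 := integral_scales_shear (Lii o3) m3 s3.
eexists; last first.
  set phi := (X in integral_scales _ _ X) in s4.
  rewrite (_ : linmap4 L = phi); first exact: s4.
  apply/funext => -[[[a b] c'] d].
  by rewrite /linmap4 /uncol4 !mul_col4 /phi/= (L0 o0 o1)// (L0 o0 o2)// (L0 o0 o3)//
    (L0 o1 o2)// (L0 o1 o3)// (L0 o2 o3)// !mul0r !addr0 add0r.
by rewrite !mulr_gt0// invr_gt0 normr_gt0.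
Qed.

Lemma mul_perm_col4 (s : {perm 'I_4}) p i : (perm_mx s *m col4 p) i 0 = col4 p (s i) 0.
Proof. by rewrite -row_permE mxE. Qed.

(** The adjacent transpositions are exchanges of integrals, extended to the remaining coordinates by
    trivial shears of slope 1 and translation 0. *)
Lemma scales4_tperm01 : scales4 (perm_mx (tperm o0 o1)).
Proof.
have s2 := integral_scales_swap2 mu.
have m2 := measurable_cst (0 : mR).
have s3 := integral_scales_shear (oner_neq0 R) (m2 _ _ _) s2.
have s4 := integral_scales_shear (oner_neq0 R) (m2 _ _ _) s3.
eexists; last first.
  set phi := (X in integral_scales _ _ X) in s4.
  rewrite (_ : linmap4 _ = phi); first exact: s4.
  apply/funext => -[[[a b] c'] d].
  by rewrite /linmap4 /uncol4 !mul_perm_col4 !permE/= !mxE /phi/= !add0r !mul1r.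
by rewrite normr1 invr1 !mul1r.
Qed.

Lemma scales4_tperm12 : scales4 (perm_mx (tperm o1 o2)).
Proof.
have s3 := integral_scales_swap3 mu mu.
have m2 := measurable_cst (0 : mR).
have s4 := integral_scales_shear (oner_neq0 R) (m2 _ _ _) s3.
eexists; last first.
  set phi := (X in integral_scales _ _ X) in s4.
  rewrite (_ : linmap4 _ = phi); first exact: s4.
  apply/funext => -[[[a b] c'] d].
  by rewrite /linmap4 /uncol4 !mul_perm_col4 !permE/= !mxE /phi/= !add0r !mul1r.
by rewrite normr1 invr1 !mul1r.
Qed.

Lemma scales4_tperm23 : scales4 (perm_mx (tperm o2 o3)).
Proof.
have s4 := integral_scales_swap3 (prod_sfm mu mu) mu.
exists 1 => //.
set phi := (X in integral_scales _ _ X) in s4.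
rewrite (_ : linmap4 _ = phi); first exact: s4.
apply/funext => -[[[a b] c'] d].
by rewrite /linmap4 /uncol4 !mul_perm_col4 !permE/= !mxE /phi/=.
Qed.

Lemma scales4_1 : scales4 1%:M.
Proof.
apply: scales4_lower; last by rewrite det1 oner_neq0.
by move=> i j ij; rewrite mxE -val_eqE/= ltn_eqF.
Qed.

Lemma scales4_tperm_conj (x y z : 'I_4) :
  x != z -> y != z -> x != y ->
  scales4 (perm_mx (tperm x y)) -> scales4 (perm_mx (tperm y z)) ->
  scales4 (perm_mx (tperm x z)).
Proof.
move=> xz yz xy sxy syz.
(* Conjugating [(y z)] by [(x y)] gives [(x z)], so adjacent transpositions generate the others. *)
have -> : tperm x z = (tperm x y * tperm y z * tperm x y)%g.
  by rewrite -{1}(tpermV x y) -mulgA -conjgE tpermJ tpermR tpermD// eq_sym.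
by rewrite !perm_mxM; do 2?apply: scales4M.
Qed.

Lemma scales4_perm (s : {perm 'I_4}) : scales4 (perm_mx s).
Proof.
have [ts -> _] := prod_tpermP s.
apply: (big_ind (fun s => scales4 (perm_mx s))).
- by rewrite perm_mx1; exact: scales4_1.
- by move=> u v su sv; rewrite perm_mxM; exact: scales4M.
move=> [i j] _ /=.
have s02 : scales4 (perm_mx (tperm o0 o2)).
  exact: (scales4_tperm_conj _ _ _ scales4_tperm01 scales4_tperm12).
have s13 : scales4 (perm_mx (tperm o1 o3)).
  exact: (scales4_tperm_conj _ _ _ scales4_tperm12 scales4_tperm23).
have s03 : scales4 (perm_mx (tperm o0 o3)).
  exact: (scales4_tperm_conj _ _ _ s02 scales4_tperm23).
have s01 := scales4_tperm01; have s12 := scales4_tperm12; have s23 := scales4_tperm23.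
have s1 := scales4_1.
apply: (@ord4_sym_ind (fun i j => scales4 (perm_mx (tperm i j))));
  [by move=> x y; rewrite tpermC| |exact: s01|exact: s02|exact: s03|exact: s12|exact: s13|exact: s23].
by move=> x; rewrite tperm1 perm_mx1.
Qed.

(** Conjugation by the involution [w] that reverses the order of the coordinates makes [U] lower
    triangular. *)
Lemma scales4_upper (U : 'M[R]_4) :
  (forall i j : 'I_4, (j < i)%N -> U i j = 0) -> \det U != 0 -> scales4 U.
Proof.
move=> U0 detU; pose w := perm_mx (perm (@rev_ord_inj 4)) : 'M[R]_4.
have sw : scales4 w by exact: scales4_perm.
have ww : w *m w = 1%:M.
  rewrite -perm_mxM -perm_mx1; congr perm_mx.
  by apply/permP => i; rewrite permM !permE rev_ordK.
have -> : U = w *m (w *m U *m w) *m w.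
  by rewrite !mulmxA ww mul1mx -mulmxA ww mulmx1.
apply: scales4M => //; apply: scales4M => //.
have wV : w^T = w.
  by rewrite -[w^T]mulmx1 -ww mulmxA tr_perm_mx -perm_mxM mulVg perm_mx1 mul1mx.
apply: scales4_lower.
  move=> i j ij; rewrite -{2}wV tr_perm_mx -col_permE mxE -row_permE mxE !permE.
  by rewrite U0//; move: i j ij; apply: ord4P; apply: ord4P.
rewrite !det_mulmx !mulf_neq0//; apply/eqP => w0; move: (congr1 determinant ww);
  by rewrite det_mulmx w0 mul0r det1 => /esym/eqP; rewrite oner_eq0.
Qed.

Lemma scales4_unit (A : 'M[R]_4) : A \in unitmx -> scales4 A.
Proof.
move=> uA.
have [s [L [U [AE HL HU detL]]]] := lup_decomposition A.
have detU : \det U != 0.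
  move: uA; rewrite unitmxE unitfE AE !det_mulmx !mulf_eq0 !negb_or.
  by case/andP => _ /andP[].
rewrite AE; apply: scales4M; first exact: scales4_perm.
apply: scales4M; last exact: scales4_upper.
apply: scales4_lower; last by rewrite detL oner_neq0.
by move=> i j ij; rewrite (HL i j (ltnW ij)) -val_eqE/= (ltn_eqF ij).
Qed.

End linear_substitution.

(** * Gaussian expectations and orthogonal invariance *)

Section integral_invariance.
Local Open Scope ereal_scope.
Context d (T : measurableType d) (R : realType) (m : {measure set T -> \bar R}).

(** With constant 1, the identity for nonnegative functions applies to the positive and negative
    parts separately, hence to functions of any sign. *)
Lemma integral_scales1 (phi : T -> T) (g : T -> \bar R) :
  integral_scales m 1 phi -> measurable_fun setT g ->
  \int[m]_x g (phi x) = \int[m]_x g x.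
Proof.
move=> [mphi phiP] mg; rewrite integralE [RHS]integralE.
congr (_ - _).
  transitivity (\int[m]_x g^\+ (phi x)); first by apply: eq_integral => x _; rewrite funepos_comp.
  by rewrite (phiP _ (measurable_funepos mg))// mul1e.
transitivity (\int[m]_x g^\- (phi x)); first by apply: eq_integral => x _; rewrite funeneg_comp.
by rewrite (phiP _ (measurable_funeneg mg))// mul1e.
Qed.

Lemma integrable_scales1 (phi : T -> T) (g : T -> \bar R) :
  integral_scales m 1 phi -> m.-integrable setT g -> m.-integrable setT (g \o phi).
Proof.
move=> [mphi phiP] /integrableP[mg ig]; apply/integrableP.
split; first exact: measurableT_comp.
rewrite (phiP (fun x => `|g x|)) ?mul1e//; exact: measurableT_comp.
Qed.

End integral_invariance.

Section gauss4.
Context {R : realType}.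
Local Notation mu := (@lebesgue_measure R).
Local Notation mR := (measurableTypeR R).
Local Notation R4 := (mR * mR * mR * mR)%type.
Local Notation lam4 := (prod_sfm (prod_sfm (prod_sfm mu mu) mu) mu).

Definition gauss4_pdf (sigma : R) (p : R4) : R :=
  normal_pdf 0 sigma p.1.1.1 * normal_pdf 0 sigma p.1.1.2 *
  normal_pdf 0 sigma p.1.2 * normal_pdf 0 sigma p.2.

Lemma gauss4_pdf_ge0 sigma p : 0 <= gauss4_pdf sigma p.
Proof. by rewrite !mulr_ge0// normal_pdf_ge0. Qed.

Lemma measurable_gauss4_pdf sigma : measurable_fun setT (gauss4_pdf sigma).
Proof.
have mn := measurable_normal_pdf (0 : R) sigma.
by do 3?apply: measurable_funM; apply: (measurableT_comp mn);
  do ?apply: measurableT_comp.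
Qed.

(** The density depends on [p] only through its squared Euclidean norm, which orthogonal maps
    preserve. *)
Lemma gauss4_pdfE sigma (p : R4) : sigma != 0 -> gauss4_pdf sigma p =
  normal_peak sigma ^+ 4 *
  expR (- (((col4 p)^T *m col4 p) 0 0) / (sigma ^+ 2 *+ 2)).
Proof.
move=> s0; rewrite /gauss4_pdf normal_pdfE// /normal_fun !subr0 mxE sum_ord4 !mxE/=.
rewrite !opprD !mulrDl !expRD -!expr2 !mulNr; ring.
Qed.

Lemma gauss4_pdf_orth sigma (O : 'M[R]_4) p : sigma != 0 -> O^T *m O = 1%:M ->
  gauss4_pdf sigma (linmap4 O p) = gauss4_pdf sigma p.
Proof.
move=> s0 OO; rewrite !gauss4_pdfE// /linmap4 uncol4K trmx_mul mulmxA.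
by rewrite -(mulmxA _ O^T) OO mulmx1.
Qed.

Lemma integral_gauss4_pdf sigma : (\int[lam4]_p (gauss4_pdf sigma p)%:E = 1)%E.
Proof.
have n0 x : (0 <= (normal_pdf 0 sigma x)%:E :> \bar R)%E by rewrite lee_fin normal_pdf_ge0.
have mn : measurable_fun setT (fun x : R => (normal_pdf 0 sigma x)%:E).
  by apply/measurable_EFinP; exact: measurable_normal_pdf.
have I (c : R) : 0 <= c -> (\int[mu]_x (c * normal_pdf 0 sigma x)%:E = c%:E)%E.
  move=> c0; under eq_integral do rewrite EFinM.
  by rewrite ge0_integralZl// integral_normal_pdf mule1.
have mg : measurable_fun setT (fun p : R4 => (gauss4_pdf sigma p)%:E).
  by apply/measurable_EFinP; exact: measurable_gauss4_pdf.
have g0 (p : R4) : (0 <= (gauss4_pdf sigma p)%:E)%E by rewrite lee_fin gauss4_pdf_ge0.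
rewrite (ge0_integral_prod4 _ _ _ _ mg g0).
(* The right-hand side is expanded into nested integrals, one normal factor at a time, to match the
   left-hand side. *)
rewrite -(integral_normal_pdf 0 sigma); apply: eq_integral => a _.
rewrite -(I (normal_pdf 0 sigma a)) ?normal_pdf_ge0//; apply: eq_integral => b _.
rewrite -(I (normal_pdf 0 sigma a * normal_pdf 0 sigma b)) ?mulr_ge0 ?normal_pdf_ge0//.
apply: eq_integral => c _.
by rewrite -I ?mulr_ge0 ?normal_pdf_ge0.
Qed.

(* The scaling constant of an orthogonal map is read off by integrating the
   Gaussian density itself. *)
Lemma integral_scales_orth (O : 'M[R]_4) : O^T *m O = 1%:M ->
  integral_scales lam4 1 (linmap4 O).
Proof.
move=> OO; have [] : scales4 O by apply: scales4_unit; have [] := mulmx1_unit OO.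
move=> c c0 [mO H]; suff <- : c = 1 by split.
have mg : measurable_fun setT (fun p : R4 => (gauss4_pdf 1 p)%:E).
  by apply/measurable_EFinP; exact: measurable_gauss4_pdf.
have g0 (p : R4) : (0 <= (gauss4_pdf 1 p)%:E)%E by rewrite lee_fin gauss4_pdf_ge0.
have := H _ mg g0; rewrite (eq_integral (fun p => (gauss4_pdf 1 p)%:E)).
  by rewrite integral_gauss4_pdf mule1 => -[].
by move=> p _; rewrite gauss4_pdf_orth ?oner_neq0.
Qed.

Definition gauss4E (sigma : R) (u : R4 -> R) : R :=
  \int[lam4]_p (gauss4_pdf sigma p * u p).

Definition gauss4_integrable (sigma : R) (u : R4 -> R) : Prop :=
  lam4.-integrable setT (fun p => (gauss4_pdf sigma p * u p)%:E).

Definition uncurry4 A (g : R -> R -> R -> R -> A) (p : R4) : A :=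
  g p.1.1.1 p.1.1.2 p.1.2 p.2.

(** Fubini links the iterated integral to one integral over the product measure. Integrability is
    required because products of residual components change sign. *)
Lemma gaussE_integrable sigma (g : R -> R -> R -> R -> R) :
  gauss4_integrable sigma (uncurry4 g) ->
  gaussE sigma (fun a b c d => (g a b c d)%:E) =
    (gauss4E sigma (uncurry4 g))%:E.
Proof.
move=> ig; rewrite /gauss4E /Rintegral fineK; last exact: integrable_fin_num.
by rewrite integral_prod4.
Qed.

Lemma gaussE_ge0 sigma (g : R -> R -> R -> R -> R) :
  measurable_fun setT (uncurry4 g) -> (forall a b c d, 0 <= g a b c d) ->
  gaussE sigma (fun a b c d => (g a b c d)%:E) =
    (\int[lam4]_p (gauss4_pdf sigma p * uncurry4 g p)%:E)%E.
Proof.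
move=> mg g0; rewrite ge0_integral_prod4//.
- apply/measurable_EFinP; apply: measurable_funM => //.
  exact: measurable_gauss4_pdf.
- by move=> p; rewrite lee_fin mulr_ge0// ?gauss4_pdf_ge0//; exact: g0.
Qed.

Lemma gauss4_integrable_sqr sigma (g : R -> R -> R -> R -> R) :
  measurable_fun setT (uncurry4 g) -> (forall a b c d, 0 <= g a b c d) ->
  (gaussE sigma (fun a b c d => (g a b c d)%:E) < +oo)%E ->
  gauss4_integrable sigma (uncurry4 g).
Proof.
move=> mg g0; rewrite gaussE_ge0// => fg; apply/integrableP; split.
  by apply/measurable_EFinP; apply: measurable_funM => //; exact: measurable_gauss4_pdf.
rewrite (eq_integral (fun p => (gauss4_pdf sigma p * uncurry4 g p)%:E))// => p _.
by rewrite gee0_abs// lee_fin mulr_ge0 ?gauss4_pdf_ge0//; exact: g0.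
Qed.

Lemma gauss4_integrableM sigma (u v : R4 -> R) :
  measurable_fun setT u -> measurable_fun setT v ->
  gauss4_integrable sigma (fun p => u p ^+ 2) ->
  gauss4_integrable sigma (fun p => v p ^+ 2) ->
  gauss4_integrable sigma (fun p => u p * v p).
Proof.
move=> mu_ mv iu iv.
have muv : measurable_fun setT (fun p => (gauss4_pdf sigma p * (u p * v p))%:E).
  apply/measurable_EFinP; apply: measurable_funM; first exact: measurable_gauss4_pdf.
  exact: measurable_funM.
(* Domination by [u ^+ 2 + v ^+ 2], which bounds the absolute value of [u * v]. *)
refine (le_integrable measurableT muv _ (integrableD measurableT iu iv)).
move=> p _; rewrite /= lee_fin -mulrDr normrM [leRHS]normrM.
rewrite ler_wpM2l// [leRHS]ger0_norm ?addr_ge0 ?sqr_ge0//.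
by rewrite ler_norml; apply/andP; split; nra.
Qed.

Lemma gauss4_integrableD sigma (u v : R4 -> R) :
  gauss4_integrable sigma u -> gauss4_integrable sigma v ->
  gauss4_integrable sigma (fun p => u p + v p).
Proof.
move=> iu iv; have := integrableD measurableT iu iv.
by apply: eq_integrable => // p _; rewrite /= -EFinD mulrDr.
Qed.

Lemma gauss4_integrableZ sigma k (u : R4 -> R) :
  gauss4_integrable sigma u -> gauss4_integrable sigma (fun p => k * u p).
Proof.
move=> iu; have := integrableZl measurableT k iu.
by apply: eq_integrable => // p _; rewrite /= -EFinM mulrCA.
Qed.

Lemma gauss4ED sigma (u v : R4 -> R) :
  gauss4_integrable sigma u -> gauss4_integrable sigma v ->
  gauss4E sigma (fun p => u p + v p) = gauss4E sigma u + gauss4E sigma v.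
Proof.
move=> iu iv; rewrite /gauss4E -RintegralD//.
by apply: eq_Rintegral => p _; rewrite mulrDr.
Qed.

Lemma gauss4EZ sigma k (u : R4 -> R) : gauss4_integrable sigma u ->
  gauss4E sigma (fun p => k * u p) = k * gauss4E sigma u.
Proof.
move=> iu; rewrite /gauss4E -RintegralZl//.
by apply: eq_Rintegral => p _; rewrite mulrCA.
Qed.

Lemma gauss4_integrable_orth sigma (O : 'M[R]_4) u : sigma != 0 ->
  O^T *m O = 1%:M -> gauss4_integrable sigma u ->
  gauss4_integrable sigma (u \o linmap4 O).
Proof.
move=> s0 OO /(integrable_scales1 (integral_scales_orth OO)).
by apply: eq_integrable => // p _; rewrite /= gauss4_pdf_orth.
Qed.

Lemma gauss4E_orth sigma (O : 'M[R]_4) u : sigma != 0 ->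
  O^T *m O = 1%:M -> measurable_fun setT u ->
  gauss4E sigma (u \o linmap4 O) = gauss4E sigma u.
Proof.
move=> s0 OO mu_; rewrite /gauss4E /Rintegral; congr fine.
rewrite -(@integral_scales1 _ _ _ _ _ (fun p => (gauss4_pdf sigma p * u p)%:E)
  (integral_scales_orth OO)).
  by apply: eq_integral => p _; rewrite /= gauss4_pdf_orth.
apply/measurable_EFinP; apply: measurable_funM => //.
exact: measurable_gauss4_pdf.
Qed.

End gauss4.

Lemma sum_ord2 (V : nmodType) (F : 'I_2 -> V) : \sum_i F i = F 0 + F 1.
Proof. by rewrite big_ord_recl big_ord1; congr (_ + F _); exact: val_inj. Qed.

(** * Covariance of a rotated and linearly transformed residual *)

Section covariance.
Context {R : realType}.
Local Notation mR := (measurableTypeR R).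
Local Notation R4 := (mR * mR * mR * mR)%type.
Variables (sigma : R) (O : 'M[R]_4) (B : 'M[R]_2).
Variables e e' : R -> R -> R -> R -> 'cV[R]_2.
Hypothesis s0 : sigma != 0.
Hypothesis OO : O^T *m O = 1%:M.
Hypothesis e'E : forall p : R4, uncurry4 e' p = B *m uncurry4 e (linmap4 O p).
Hypothesis me : forall i, measurable_fun setT (fun p => uncurry4 e p i 0).
Hypothesis fin_e : forall i,
  (gaussE sigma (fun a b c d => ((e a b c d i 0) ^+ 2)%:E) < +oo)%E.

Let u i p := uncurry4 e p i 0.

Let iu i j : gauss4_integrable sigma (fun p => u i p * u j p).
Proof.
have sq k : gauss4_integrable sigma (fun p => u k p ^+ 2).
  apply: (gauss4_integrable_sqr (g := fun a b c d => e a b c d k 0 ^+ 2)) => //.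
    exact: measurable_funX (me k).
  by move=> *; exact: sqr_ge0.
by apply: gauss4_integrableM; [exact: me i|exact: me j|exact: sq|exact: sq].
Qed.

(** The [(i, j)] entry of [B e e^T B^T], expanded into four terms to which linearity of the
    expectation applies. *)
Let w i j p := B i 0 * B j 0 * (u 0 p * u 0 p) + B i 0 * B j 1 * (u 0 p * u 1 p) +
  B i 1 * B j 0 * (u 1 p * u 0 p) + B i 1 * B j 1 * (u 1 p * u 1 p).

Let mw i j : measurable_fun setT (w i j).
Proof.
by do 3?apply: measurable_funD; do 2!apply: measurable_funM => //; exact: me.
Qed.

Let iw i j : gauss4_integrable sigma (w i j).
Proof.
by do 3?apply: gauss4_integrableD; apply: gauss4_integrableZ; exact: iu.
Qed.

Let e'w i j : uncurry4 (fun a b c d => e' a b c d i 0 * e' a b c d j 0) =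
  w i j \o linmap4 O.
Proof.
apply/funext => p; transitivity (uncurry4 e' p i 0 * uncurry4 e' p j 0) => //.
by rewrite e'E !mxE !sum_ord2 /w /u/=; ring.
Qed.

Let gaussE_e' i j :
  gaussE sigma (fun a b c d => (e' a b c d i 0 * e' a b c d j 0)%:E) =
  (gauss4E sigma (w i j))%:E.
Proof.
rewrite gaussE_integrable e'w ?gauss4E_orth//.
by apply: gauss4_integrable_orth => //; exact: iw.
Qed.

(** The square is the diagonal product, whose expectation has just been identified with a real
    number. *)
Lemma finite_second_moments_linear i :
  (gaussE sigma (fun a b c d => ((e' a b c d i 0) ^+ 2)%:E) < +oo)%E.
Proof. by have := gaussE_e' i i; rewrite /gaussE => ->; rewrite ltry. Qed.

(** Rotation invariance removes [O]; what remains is bilinearity of the second moments. *)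
Lemma covariance_linear :
  \matrix_(i < 2, j < 2) fine (gaussE sigma (fun a b c d =>
      (e' a b c d i 0 * e' a b c d j 0)%:E)) =
  B *m (\matrix_(i < 2, j < 2) fine (gaussE sigma (fun a b c d =>
      (e a b c d i 0 * e a b c d j 0)%:E))) *m B^T.
Proof.
set V := (X in B *m X).
have VE k l : V k l = gauss4E sigma (fun p => u k p * u l p).
  by rewrite mxE gaussE_integrable//; exact: iu.
apply/matrixP => i j; rewrite mxE gaussE_e'/=.
have iZ c k l : gauss4_integrable sigma (fun p => c * (u k p * u l p)).
  by apply: gauss4_integrableZ; exact: iu.
rewrite gauss4ED; [|by do ?apply: gauss4_integrableD; exact: iZ|exact: iZ].
rewrite gauss4ED; [|by do ?apply: gauss4_integrableD; exact: iZ|exact: iZ].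
rewrite gauss4ED; [|exact: iZ|exact: iZ].
rewrite (gauss4EZ _ (iu 0 0)) (gauss4EZ _ (iu 0 1)) (gauss4EZ _ (iu 1 0)) (gauss4EZ _ (iu 1 1)).
rewrite -!VE [RHS]mxE sum_ord2 ![(B *m V) _ _]mxE !sum_ord2 ![B^T _ _]mxE.
by ring.
Qed.

End covariance.

(** * Measurability of the residual *)

Section residual_measurable.
Context {R : realType}.
Local Notation mR := (measurableTypeR R).
Local Notation R4 := (mR * mR * mR * mR)%type.

Lemma measurable_redmod (a : R) : measurable_fun setT (redmod a).
Proof.
apply: measurable_funB => //; apply: measurable_funM => //.
apply: (@measurableT_comp _ _ _ _ _ _ (fun x : R => (Num.floor x)%:~R : R)).
  (* The floor function is measurable because it is monotone. *)
  apply: nondecreasing_measurable => // x y xy.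
  by rewrite ler_int; exact: le_floor.
by apply: measurable_funM => //; exact: measurable_funD.
Qed.

Lemma measurable_residual (S : 'M[R]_(2 + 2)) (M : 'M[R]_2) (f : R * R -> R * R) i :
  measurable_fun setT f ->
  measurable_fun setT (fun p : R4 => uncurry4 (residual S M f) p i 0).
Proof.
move=> mf.
pose s k (p : R4) := redmod (sqrt2pi R)
  ((M^T *m Omega1 R *m dsubmx (invmx S *m col4 p)) k 0).
have ms k : measurable_fun setT (s k).
  apply: (measurableT_comp (@measurable_redmod _)).
  under eq_fun do rewrite mxE sum_ord2.
  apply: measurable_funD; apply: measurable_funM => //;
    by under eq_fun do rewrite mxE; exact: measurable_mul_col4.
have mfs : measurable_fun setT (fun p => f (s 0 p, s 1 p)).
  by apply: measurableT_comp => //; exact: measurable_fun_pair.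
rewrite (_ : (fun p => _) = fun p => (invmx S *m col4 p : 'cV[R]_4) (lshift 2 i) 0 -
    (if i == 0 :> nat then (f (s 0 p, s 1 p)).1 else (f (s 0 p, s 1 p)).2)); last first.
  apply/funext => p; rewrite /uncurry4 /residual mxE [usubmx _ _ _]mxE.
  rewrite [(- cv2 _) _ _]mxE [cv2 _ _ _]mxE.
  by rewrite (_ : pr2 _ = (s 0 p, s 1 p))// /pr2 [Rred _ 0 0]mxE [Rred _ 1 0]mxE.
apply: measurable_funB; first exact: measurable_mul_col4.
by case: (i == 0 :> nat); exact: measurableT_comp.
Qed.

End residual_measurable.

(** * Modewise decomposition of two-mode symplectic matrices *)

Section modewise.
Context {R : realType}.
Local Notation Om := (Omega1 R).

Definition mx2 (a b c d : R) : 'M[R]_2 :=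
  \matrix_(i < 2, j < 2) (if i == 0 then (if j == 0 then a else b)
                          else (if j == 0 then c else d)).

Lemma ord2P (P : 'I_2 -> Prop) : P 0 -> P 1 -> forall i, P i.
Proof.
by move=> P0 P1 [[|[|//]] Hi]; [rewrite (_ : Ordinal Hi = 0)|rewrite (_ : Ordinal Hi = 1)]; do ?exact: val_inj.
Qed.

Lemma mx2E (X : 'M[R]_2) : X = mx2 (X 0 0) (X 0 1) (X 1 0) (X 1 1).
Proof. by apply/matrixP; do 2!apply: ord2P; rewrite mxE. Qed.

Lemma mul_mx2 a b c d a' b' c' d' : mx2 a b c d *m mx2 a' b' c' d' =
  mx2 (a * a' + b * c') (a * b' + b * d') (c * a' + d * c') (c * b' + d * d').
Proof. by apply/matrixP; do 2!apply: ord2P; rewrite !mxE sum_ord2 !mxE. Qed.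

Lemma tr_mx2 a b c d : (mx2 a b c d)^T = mx2 a c b d.
Proof. by apply/matrixP; do 2!apply: ord2P; rewrite !mxE. Qed.

Lemma add_mx2 a b c d a' b' c' d' : mx2 a b c d + mx2 a' b' c' d' =
  mx2 (a + a') (b + b') (c + c') (d + d').
Proof. by apply/matrixP; do 2!apply: ord2P; rewrite !mxE. Qed.

Lemma scale_mx2 k a b c d : k *: mx2 a b c d = mx2 (k * a) (k * b) (k * c) (k * d).
Proof. by apply/matrixP; do 2!apply: ord2P; rewrite !mxE. Qed.

Lemma opp_mx2 a b c d : - mx2 a b c d = mx2 (- a) (- b) (- c) (- d).
Proof. by apply/matrixP; do 2!apply: ord2P; rewrite !mxE. Qed.

Lemma Omega1E : Om = mx2 0 1 (-1) 0.
Proof. by apply/matrixP; do 2!apply: ord2P; rewrite !mxE. Qed.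

Lemma ZmxE : Zmx R = mx2 1 0 0 (-1).
Proof. by apply/matrixP; do 2!apply: ord2P; rewrite !mxE. Qed.

Lemma scalar_mx2 k : k%:M = mx2 k 0 0 k.
Proof. by apply/matrixP; do 2!apply: ord2P; rewrite !mxE. Qed.

Lemma det_mx2 a b c d : \det (mx2 a b c d) = a * d - b * c.
Proof.
rewrite (expand_det_row _ 0) sum_ord2 /cofactor !det_mx11 !mxE/=; ring.
Qed.

(** This turns block relations involving [Omega1] into relations between determinants, and
    identifies Sp(2) with SL(2). *)
Lemma mul_Omega1_tr (X : 'M[R]_2) : X *m Om *m X^T = \det X *: Om.
Proof.
by rewrite (mx2E X) Omega1E tr_mx2 !mul_mx2 det_mx2 scale_mx2; congr mx2; ring.
Qed.

Lemma symplectic2P (X : 'M[R]_2) : symplectic Om X <-> \det X = 1.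
Proof.
rewrite /symplectic mul_Omega1_tr; split=> [/matrixP/(_ 0 1)|->]; last by rewrite scale1r.
by rewrite !mxE mulr1.
Qed.


(** [P] is the Gram matrix of the two rows of the 2 by 4 matrix [[X Y]]; two of its minors sum to 1,
    so the rows are independent. *)
Lemma gram2_gt0 (X Y : 'M[R]_2) (P := X *m X^T + Y *m Y^T) :
  \det X + \det Y = 1 -> 0 < P 0 0 /\ 0 < \det P.
Proof.
rewrite /P (mx2E X) (mx2E Y).
move: (X 0 0) (X 0 1) (X 1 0) (X 1 1) => x1 x2 x3 x4.
move: (Y 0 0) (Y 0 1) (Y 1 0) (Y 1 1) => y1 y2 y3 y4.
rewrite !tr_mx2 !mul_mx2 add_mx2 !det_mx2 mxE/= => H.
set a := _ + _ + (_ + _); set d := (X in _ /\ 0 < X).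
(* Lagrange's identity: a Gram determinant is the sum of the squared minors. *)
have dE : d = (x1 * x4 - x2 * x3) ^+ 2 + (y1 * y4 - y2 * y3) ^+ 2 +
    (x1 * y3 - y1 * x3) ^+ 2 + (x1 * y4 - y2 * x3) ^+ 2 +
    (x2 * y3 - y1 * x4) ^+ 2 + (x2 * y4 - y2 * x4) ^+ 2.
  by rewrite /d /a; ring.
have d0 : 0 < d.
  rewrite dE; set m := x1 * x4 - _ in H *; set n := y1 * y4 - _ in H *.
  have : 0 < m ^+ 2 + n ^+ 2.
    have -> : n = 1 - m by rewrite -H addrC addKr.
    have -> : m ^+ 2 + (1 - m) ^+ 2 = 2 * (m - 2^-1) ^+ 2 + 2^-1 by field.
    by rewrite ltr_wpDl// mulr_ge0// sqr_ge0.
  by move=> mn; do 4!(apply: ltr_pwDl; last exact: sqr_ge0).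
split => //.
have a0 : 0 <= a by rewrite /a -!expr2 !addr_ge0 ?sqr_ge0.
rewrite lt_neqAle a0 andbT; apply/eqP => aE.
(* If the corner entry [a] vanished, the determinant would be minus a square. *)
have dF : d = a * (x3 * x3 + x4 * x4 + (y3 * y3 + y4 * y4)) -
    (x1 * x3 + x2 * x4 + (y1 * y3 + y2 * y4)) ^+ 2 by rewrite /d; ring.
by move: d0; rewrite dF -aE mul0r sub0r oppr_gt0 ltNge sqr_ge0.
Qed.

(** A Cholesky factorization with the square root [v] of the determinant pulled out, so that the
    triangular factor has diagonal [t], [t^-1] and determinant 1. *)
Lemma cholesky2 (a b c v : R) : 0 < a -> 0 < v -> a * c - b * b = v ^+ 2 ->
  exists2 A : 'M[R]_2, \det A = 1 & v *: (A *m A^T) = mx2 a b b c.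
Proof.
move=> a0 v0 acv; pose t := Num.sqrt (a / v).
have t0 : 0 < t by rewrite sqrtr_gt0 divr_gt0.
have tt : t * t = a / v by rewrite -expr2 sqr_sqrtr// ltW// divr_gt0.
have tn : t != 0 by rewrite gt_eqF.
have an : a != 0 by rewrite gt_eqF.
have vn : v != 0 by rewrite gt_eqF.
exists (mx2 t 0 (b / (v * t)) t^-1).
  by rewrite det_mx2 mul0r subr0 divff.
rewrite tr_mx2 mul_mx2 scale_mx2 !mulr0 !mul0r !addr0; congr mx2.
- by rewrite tt; field.
- by field; apply/andP.
- by field; apply/andP.
- have -> : b / (v * t) * (b / (v * t)) + t^-1 / t = (b * b + v ^+ 2) / (v * v * (t * t)).
    by field; apply/andP.
  by rewrite tt -acv; field; apply/andP.
Qed.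

Lemma anticommuting_Omega1 (C : 'M[R]_2) : Om *m C + C *m Om = 0 ->
  exists p q, C = mx2 p q q (- p).
Proof.
rewrite (mx2E C); move: (C 0 0) (C 0 1) (C 1 0) (C 1 1) => p q r s.
rewrite Omega1E !mul_mx2 add_mx2 => /matrixP E; exists p, q.
by have := E 0 0; have := E 0 1; rewrite !mxE/= => E1 E2; congr mx2; lra.
Qed.

(** The matrix is [k] times a reflection, which a rotation [W] carries to [- Zmx]. The sign is that
    of the off-diagonal blocks of the inverse of [S_TMS]. *)
Lemma reflection_normal_form (p q k : R) : 0 <= k -> k ^+ 2 = p ^+ 2 + q ^+ 2 ->
  exists W : 'M[R]_2, [/\ \det W = 1, W *m W^T = 1%:M &
    mx2 p q q (- p) *m W = - k *: Zmx R].
Proof.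
move=> k0 kpq; have [k00|kn] := eqVneq k 0.
  have [p0 q0] : p = 0 /\ q = 0.
    by move: kpq; rewrite k00; split; nra.
  exists 1%:M; split; rewrite ?det1 ?trmx1 ?mulmx1//.
  by rewrite k00 p0 q0 !oppr0 scale0r; apply/matrixP; do 2!apply: ord2P; rewrite !mxE.
have kk : k * k = p * p + q * q by rewrite -!expr2.
exists (- k^-1 *: mx2 p (- q) q p).
rewrite scale_mx2 det_mx2 tr_mx2 !mul_mx2 ZmxE scalar_mx2 scale_mx2; split.
- have -> : - k^-1 * p * (- k^-1 * p) - - k^-1 * - q * (- k^-1 * q) =
     (p * p + q * q) / (k * k) by field.
  by rewrite kk divff// -kk mulf_neq0.
- congr mx2; try by field.
  + have -> : - k^-1 * p * (- k^-1 * p) + - k^-1 * - q * (- k^-1 * - q) =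
     (p * p + q * q) / (k * k) by field.
    by rewrite kk divff// -kk mulf_neq0.
  + have -> : - k^-1 * q * (- k^-1 * q) + - k^-1 * p * (- k^-1 * p) =
     (p * p + q * q) / (k * k) by field.
    by rewrite kk divff// -kk mulf_neq0.
- congr mx2; try by field.
  + have -> : p * (- k^-1 * p) + q * (- k^-1 * q) = - ((p * p + q * q) / k) by field.
    by rewrite -kk; field.
  + have -> : q * (- k^-1 * - q) + - p * (- k^-1 * p) = (p * p + q * q) / k by field.
    by rewrite -kk; field.
Qed.

(** * Algebra of two-mode squeezing matrices and symplectic relations *)

Lemma tr_Zmx : (Zmx R)^T = Zmx R.
Proof. by rewrite ZmxE tr_mx2. Qed.

(** Since [Zmx] squares to 1, these matrices multiply like split-complex numbers [g + h j] with
    [j^2 = 1]. The family contains [S_TMS], its inverse and the Gram matrix of that inverse. *)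
Definition tms_mx (g h : R) : 'M[R]_(2 + 2) :=
  block_mx g%:M (h *: Zmx R) (h *: Zmx R) g%:M.

Lemma tms_mxM g h g' h' :
  tms_mx g h *m tms_mx g' h' = tms_mx (g * g' + h * h') (g * h' + h * g').
Proof.
rewrite /tms_mx mulmx_block ZmxE !scalar_mx2 !scale_mx2 !mul_mx2 !add_mx2.
by congr block_mx; congr mx2; ring.
Qed.

Lemma tr_tms_mx g h : (tms_mx g h)^T = tms_mx g h.
Proof. by rewrite /tms_mx tr_block_mx !linearZ/= tr_Zmx !tr_scalar_mx. Qed.

Lemma sqrtrM_self (x : R) : 0 <= x -> Num.sqrt x * Num.sqrt x = x.
Proof. by move=> x0; rewrite -expr2 sqr_sqrtr. Qed.

Lemma invmx_S_TMS G : 1 <= G ->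
  invmx (S_TMS G) = tms_mx (Num.sqrt G) (- Num.sqrt (G - 1)).
Proof.
move=> G1; have G0 : 0 <= G by rewrite (le_trans ler01).
have SK : S_TMS G *m tms_mx (Num.sqrt G) (- Num.sqrt (G - 1)) = 1%:M.
  rewrite -[S_TMS G]/(tms_mx _ _) tms_mxM mulrN sqrtrM_self// mulrN sqrtrM_self ?subr_ge0//.
  have -> : G - (G - 1) = 1 by ring.
  by rewrite mulrC addNr /tms_mx scale0r scalar_mx_block.
have [uS _] := mulmx1_unit SK.
by rewrite -[RHS]mul1mx -(mulVmx uS) -mulmxA SK mulmx1.
Qed.

(** The gain [G = (v + 1) / 2] solves [2 G - 1 = v]; the off-diagonal entry follows from
    [4 G (G - 1) = v^2 - 1]. *)
Lemma invmx_S_TMS_gram (v : R) (K := invmx (S_TMS ((v + 1) / 2))) : 1 <= v ->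
  K *m K^T = tms_mx v (- Num.sqrt (v ^+ 2 - 1)).
Proof.
move=> v1; rewrite /K; set G := (v + 1) / 2.
have G1 : 1 <= G by rewrite /G; lra.
have G0 : 0 <= G by lra.
rewrite invmx_S_TMS// tr_tms_mx tms_mxM mulrNN !sqrtrM_self ?subr_ge0//.
have gh : 2 * (Num.sqrt G * Num.sqrt (G - 1)) = Num.sqrt (v ^+ 2 - 1).
  rewrite -sqrtrM//; have -> : v ^+ 2 - 1 = 2 ^+ 2 * (G * (G - 1)) by rewrite /G; field.
  by rewrite [RHS]sqrtrM ?exprn_ge0// sqrtr_sqr ger0_norm.
by congr tms_mx; [rewrite /G; field|rewrite -gh; ring].
Qed.

(** The relation exhibits [- W S^T W] as a right inverse of [S]; being also a left inverse, it gives
    the transposed relation. *)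
Lemma symplectic_unit n (W S : 'M[R]_n) : W *m W = - 1%:M ->
  symplectic W S -> S \in unitmx /\ S^T *m W *m S = W.
Proof.
move=> WW SW.
have SV : S *m (- (W *m S^T *m W)) = 1%:M.
  by rewrite mulmxN !mulmxA SW WW opprK.
have [uS _] := mulmx1_unit SV; split=> //.
have := mulmx1C SV; rewrite mulNmx => /(congr1 (mulmx W)).
by rewrite mulmxN !mulmxA WW mulmx1 !mulNmx opprK mul1mx.
Qed.

Lemma Omega1_sqr : Om *m Om = - 1%:M.
Proof.
by rewrite Omega1E mul_mx2 scalar_mx2 opp_mx2; congr mx2; ring.
Qed.

Lemma Omega_sqr : Omega R *m Omega R = - 1%:M.
Proof.
rewrite /Omega mulmx_block !mulmx0 !mul0mx !addr0 !add0r Omega1_sqr.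
by rewrite scalar_mx_block opp_block_mx !oppr0.
Qed.

Lemma gram_symplectic (T : 'M[R]_(2 + 2)) (Sg := T *m T^T) :
  symplectic (Omega R) T -> Sg *m Omega R *m Sg = Omega R.
Proof.
move=> TO; have [_ TO'] := symplectic_unit Omega_sqr TO.
have -> : Sg *m Omega R *m Sg = T *m (T^T *m Omega R *m T) *m T^T by rewrite !mulmxA.
by rewrite TO'.
Qed.

Lemma symplectic_invmx (S : 'M[R]_(2 + 2)) :
  symplectic (Omega R) S -> symplectic (Omega R) (invmx S).
Proof.
move=> SO; have [uS _] := symplectic_unit Omega_sqr SO.
rewrite /symplectic -[in LHS]SO !mulmxA mulVmx// mul1mx -mulmxA -trmx_mul.
by rewrite mulVmx// trmx1 mulmx1.
Qed.


Lemma modewise_decomposition (S : 'M[R]_(2 + 2)) : symplectic (Omega R) S ->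
  exists (G : R) (A B : 'M[R]_2), [/\ 1 <= G, \det A = 1, \det B = 1 &
    let O := S *m block_mx A 0 0 B *m invmx (S_TMS G) in O *m O^T = 1%:M].
Proof.
move=> symS; have [uS _] := symplectic_unit Omega_sqr symS.
have symT := symplectic_invmx symS; set T := invmx S in symT.
have SgOSg := gram_symplectic symT.
set X := ulsubmx T; set Y := ursubmx T; set Z := dlsubmx T; set W := drsubmx T.
have TE : T = block_mx X Y Z W by rewrite submxK.
pose P := X *m X^T + Y *m Y^T; pose C := X *m Z^T + Y *m W^T.
pose Q := Z *m Z^T + W *m W^T.
have SgE : T *m T^T = block_mx P C C^T Q.
  rewrite TE tr_block_mx mulmx_block; congr block_mx.
  by rewrite /C linearD/= !trmx_mul !trmxK.
have PT : P^T = P by rewrite /P linearD/= !trmx_mul !trmxK.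
have QT : Q^T = Q by rewrite /Q linearD/= !trmx_mul !trmxK.
have [detXY detZW] : \det X + \det Y = 1 /\ \det Z + \det W = 1.
  move: symT; rewrite /symplectic TE tr_block_mx /Omega !mulmx_block.
  rewrite !mulmx0 !addr0 !add0r => /eq_block_mx[E1 _ _ E2].
  move: E1 E2; rewrite !mul_Omega1_tr -!scalerDl.
  by move=> /matrixP/(_ 0 1) + /matrixP/(_ 0 1); rewrite !mxE !mulr1.
have [P0 detP] : 0 < P 0 0 /\ 0 < \det P := gram2_gt0 detXY.
have [Q0 detQ] : 0 < Q 0 0 /\ 0 < \det Q := gram2_gt0 detZW.
(* The Gram matrix is symmetric and itself symplectic: its diagonal blocks give the determinant
   relations, an off-diagonal block gives the last equation. *)
have [detPC detQC PCQ] : [/\ \det P + \det C = 1, \det Q + \det C = 1 &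
    P *m Om *m C + C *m Om *m Q = 0].
  move: SgOSg; rewrite SgE /Omega !mulmx_block !mulmx0 !addr0 !add0r.
  move=> /eq_block_mx[E1 E2 _ E4]; split => //.
  - move: E1; rewrite -{2}PT !mul_Omega1_tr -scalerDl => /matrixP/(_ 0 1).
    by rewrite !mxE mulr1.
  - move: E4; rewrite -{2}QT -{2}[C]trmxK !mul_Omega1_tr -scalerDl det_tr addrC.
    by move=> /matrixP/(_ 0 1); rewrite !mxE mulr1.
(* [v] is the symplectic eigenvalue of both reduced blocks, as [P] and [Q] both have determinant
   [1 - \det C]. *)
pose v := Num.sqrt (\det P).
have v0 : 0 < v by rewrite sqrtr_gt0.
have vv : v ^+ 2 = \det P by rewrite sqr_sqrtr// ltW.
have vQ : v ^+ 2 = \det Q by rewrite vv; apply: (addIr (\det C)); rewrite detPC detQC.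
have chol U : U^T = U -> 0 < U 0 0 -> v ^+ 2 = \det U ->
    exists2 A : 'M[R]_2, \det A = 1 & v *: (A *m A^T) = U.
  move=> UT U0; have U10 : U 1 0 = U 0 1 by rewrite -[in LHS]UT mxE.
  rewrite (mx2E U) U10 det_mx2 => E; exact: cholesky2.
have [A detA AP] := chol P PT P0 vv; have [B detB BQ] := chol Q QT Q0 vQ.
have uA : A \in unitmx by rewrite unitmxE detA unitr1.
have uB : B \in unitmx by rewrite unitmxE detB unitr1.
have [C' CE] : exists C', C = A *m C' *m B^T.
  exists (invmx A *m C *m (invmx B)^T).
  by rewrite !mulmxA mulmxV// mul1mx -mulmxA -trmx_mul mulmxV// trmx1 mulmx1.
have AOA : A^T *m Om *m A = Om by apply: (symplectic_unit Omega1_sqr _).2; exact/symplectic2P.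
have BOB : B^T *m Om *m B = Om by apply: (symplectic_unit Omega1_sqr _).2; exact/symplectic2P.
(* Substituting the factorizations into [PCQ] and using that [A] and [B] are symplectic leaves [v]
   times this sum, between the invertible factors [A] and [B^T]. *)
have antiC' : Om *m C' + C' *m Om = 0.
  have : v *: (A *m (Om *m C' + C' *m Om) *m B^T) = 0.
    rewrite -PCQ -AP -BQ CE -!scalemxAl -!scalemxAr -scalerDr; congr (_ *: _).
    rewrite mulmxDr mulmxDl; congr (_ + _).
      by rewrite -[in LHS]AOA !mulmxA.
    by rewrite -[in LHS]BOB !mulmxA.
  move=> /eqP; rewrite scaler_eq0 gt_eqF//= => /eqP E.
  have := congr1 (fun H => invmx A *m H *m (invmx B)^T) E.
  by rewrite /= mulmx0 mul0mx -!mulmxA -trmx_mul mulVmx// trmx1 mulmx1 mulmxA mulVmx// mul1mx.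
have [p [q C'E]] := anticommuting_Omega1 antiC'.
have detC : \det C = - (p ^+ 2 + q ^+ 2).
  by rewrite CE !det_mulmx det_tr detA detB C'E det_mx2; ring.
have v2 : v ^+ 2 - 1 = p ^+ 2 + q ^+ 2.
  by rewrite vv -detPC detC; ring.
(* This bound makes the gain [(v + 1) / 2] at least 1. *)
have v1 : 1 <= v.
  rewrite -(@ler_sqr R 1 v) ?nnegrE ?ler01 ?(ltW v0)// expr1n -subr_ge0 v2.
  by rewrite addr_ge0 ?sqr_ge0.
pose k := Num.sqrt (v ^+ 2 - 1).
have kk : k ^+ 2 = p ^+ 2 + q ^+ 2 by rewrite sqr_sqrtr v2// addr_ge0 ?sqr_ge0.
have [V [detV VV C'V]] := reflection_normal_form (sqrtr_ge0 _) kk.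
(* The rotation [V] acts on the second mode: it brings [C'] to a multiple of [Zmx] and leaves
   [B *m B^T] unchanged. *)
exists ((v + 1) / 2), A, (B *m V); split => //.
- by lra.
- by rewrite det_mulmx detB detV mulr1.
set K := invmx (S_TMS _); set D := block_mx _ _ _ _.
have kZ : - k *: Zmx R = V^T *m C'.
  have <- : C'^T = C' by rewrite C'E tr_mx2.
  by rewrite -trmx_mul C'E C'V linearZ/= tr_Zmx.
have DKKD : D *m (K *m K^T) *m D^T = T *m T^T.
  rewrite invmx_S_TMS_gram// SgE /D /tms_mx tr_block_mx !trmx0 !mulmx_block.
  rewrite !mulmx0 !mul0mx !addr0 !add0r -/k; congr block_mx.
  - by rewrite -AP mul_mx_scalar scalemxAl.
  - rewrite CE C'E -C'V trmx_mul !mulmxA; congr (_ *m _).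
    by rewrite -!mulmxA VV mulmx1.
  - rewrite CE kZ !trmx_mul trmxK C'E tr_mx2 !mulmxA; congr (_ *m _ *m _).
    by rewrite -mulmxA VV mulmx1.
  - rewrite -BQ mul_mx_scalar -scalemxAl trmx_mul !mulmxA; congr (_ *: (_ *m _)).
    by rewrite -mulmxA VV mulmx1.
rewrite /= !trmx_mul.
have -> : S *m D *m K *m (K^T *m (D^T *m S^T)) = S *m (D *m (K *m K^T) *m D^T) *m S^T.
  by rewrite !mulmxA.
by rewrite DKKD !mulmxA mulmxV// mul1mx -trmx_mul mulmxV// trmx1.
Qed.

End modewise.

(** * Transport of a code to a two-mode squeezing code *)

Theorem theorem4 (R : realType) (sigma : R) (hsigma : 0 < sigma)
  (Senc : 'M[R]_(2 + 2)) (M : 'M[R]_2) (f : R * R -> R * R) :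
  symplectic (Omega R) Senc ->
  M \in unitmx ->
  measurable_fun setT f ->
  M^T *m Omega1 R *m M = (2 * pi) *: Omega1 R ->
  finite_second_moments sigma Senc M f ->
  exists (G : R) (Lambda : 'M[R]_2) (f' : R * R -> R * R),
    [/\ 1 <= G,
        symplectic (Omega1 R) Lambda,
        measurable_fun setT f',
        finite_second_moments sigma (S_TMS G) (sqrt2pi R *: (Lambda *m Omega1 R)) f'
      & gm_error sigma (S_TMS G) (sqrt2pi R *: (Lambda *m Omega1 R)) f'
        = gm_error sigma Senc M f].
Proof.
move=> symS _ mf MOM fin.
have [G [A [B [G1 detA detB]]]] := modewise_decomposition symS.
set O := _ *m _ *m _ => /= OO.
have uA : A \in unitmx by rewrite unitmxE detA unitr1.
have uB : B \in unitmx by rewrite unitmxE detB unitr1.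
have [uS _] := symplectic_unit (Omega_sqr (R := R)) symS.
have pi0 : 0 < 2 * pi :> R by rewrite mulr_gt0// pi_gt0.
have c0 : sqrt2pi R != 0 by rewrite gt_eqF// sqrtr_gt0.
pose M' := invmx B *m M.
(* Solves [M' = sqrt2pi *: (Lambda *m Omega1)]; the minus sign comes from [Omega1] squaring to
   -1. *)
pose Lambda := - (sqrt2pi R)^-1 *: (M' *m Omega1 R).
have M'E : sqrt2pi R *: (Lambda *m Omega1 R) = M'.
  rewrite /Lambda -scalemxAl scalerA mulrN divff// -mulmxA Omega1_sqr mulmxN mulmx1.
  by rewrite scaleN1r opprK.
(* Canonicity of the lattice fixes this determinant, which is exactly what makes [\det Lambda] equal
   to 1. *)
have detM : \det M = 2 * pi.
  have := mul_Omega1_tr M^T; rewrite trmxK det_tr MOM => /matrixP/(_ 0 1).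
  by rewrite !mxE !mulr1.
have symL : symplectic (Omega1 R) Lambda.
  apply/symplectic2P; rewrite detZ !det_mulmx det_inv detB invr1 mul1r detM.
  rewrite Omega1E det_mx2 sqrrN exprVn sqr_sqrtr ?ltW//.
  by rewrite mul0r sub0r mul1r opprK mulr1 mulVf// gt_eqF.
pose f' q := pr2 (invmx A *m cv2 (f q)).
have mf' : measurable_fun setT f'.
  have mcv i : measurable_fun setT (fun q => cv2 (f q) i 0).
    under eq_fun do rewrite mxE.
    by case: (i == 0 :> nat); exact: measurableT_comp.
  apply: measurable_fun_pair => /=; under eq_fun do rewrite mxE sum_ord2;
    by apply: measurable_funD; apply: measurable_funM.
(* Hence the new syndrome of an ancilla displacement [y] is the old syndrome of [B *m y]. *)
have M'O : M'^T *m Omega1 R = M^T *m Omega1 R *m B.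
  have symB : symplectic (Omega1 R) B by exact/symplectic2P.
  have [_ BOB] := symplectic_unit (Omega1_sqr (R := R)) symB.
  rewrite /M' trmx_mul -!mulmxA; congr (_ *m _).
  by rewrite -[in LHS]BOB !mulmxA -trmx_mul mulmxV// trmx1 mul1mx.
have resE (p : measurableTypeR R * measurableTypeR R * measurableTypeR R * measurableTypeR R) :
    uncurry4 (residual (S_TMS G) M' f') p =
    invmx A *m uncurry4 (residual Senc M f) (linmap4 O p).
  set q := linmap4 O p.
  have -> : uncurry4 (residual Senc M f) q =
      usubmx (invmx Senc *m col4 q) -
      cv2 (f (pr2 (Rred (M^T *m Omega1 R *m dsubmx (invmx Senc *m col4 q))))) by [].
  have -> : uncurry4 (residual (S_TMS G) M' f') p =
      usubmx (invmx (S_TMS G) *m col4 p) -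
      cv2 (f' (pr2 (Rred (M'^T *m Omega1 R *m dsubmx (invmx (S_TMS G) *m col4 p))))) by [].
  (* By the choice of [O], [invmx Senc *m O] is the direct sum of [A] and [B] times
     [invmx (S_TMS G)]. *)
  have -> : invmx Senc *m col4 q =
      block_mx A 0 0 B *m (invmx (S_TMS G) *m col4 p).
    by rewrite /q /linmap4 uncol4K /O !mulmxA mulVmx// mul1mx.
  set y : 'cV[R]_(2 + 2) := invmx (S_TMS G) *m col4 p.
  rewrite -[in RHS](vsubmxK y) mul_block_col !mul0mx addr0 add0r col_mxKu col_mxKd.
  rewrite M'O mulmxBr [invmx A *m (A *m _)]mulmxA mulVmx// mul1mx.
  congr (_ - _); rewrite /f' mulmxA; set w := _ *m cv2 _.
  by apply/colP; apply: ord2P; rewrite mxE.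
have s0 : sigma != 0 by rewrite gt_eqF.
have OO' : O^T *m O = 1%:M := mulmx1C OO.
have mres i := @measurable_residual R Senc M f i mf.
exists G, Lambda, f'; rewrite M'E.
split; [exact: G1|exact: symL|exact: mf'| |].
  by move=> i; exact: (finite_second_moments_linear s0 OO' resE mres fin).
have VE : Vout sigma (S_TMS G) M' f' =
    invmx A *m Vout sigma Senc M f *m (invmx A)^T.
  exact: (covariance_linear s0 OO' resE mres fin).
rewrite /gm_error VE !det_mulmx det_tr det_inv detA.
by rewrite invr1 mul1r mulr1.
Qed.
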